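(* Let $x_1,x_2,x_3,x_4\in E^3$ be the vertices of a regular tetrahedron with edge length $\ell>0$. (a) Among all cylinders circumscribed to the tetrahedron, there are exactly three of absolute minimal radius. The ratio of this minimal radius to $\ell$ is $1/2$. The axes of these three cylinders intersect at the center of the tetrahedron and are mutually orthogonal; they follow the directions parallel to the edges of the cube whose eight vertices are the four vertices of the tetrahedron together with the four points obtained by reflecting these vertices through the center of the tetrahedron. (b) Among all cylinders circumscribed to the tetrahedron, there are exactly six of absolute maximal radius. The ratio of this maximal radius to $\ell$ is $3\sqrt{2}/8$. The axes of these six cylinders follow the directions parallel to the (six) edges of the tetrahedron.
   Context: $E^3$ is three-dimensional Euclidean space. A cylinder is the set of points at distance at most $\rho$ from a line called its axis, where $\rho\ge 0$ is its radius. It is circumscribed to a finite set of points (here, the four vertices of the tetrahedron) if every point of the set lies on the boundary of the cylinder, i.e. at distance exactly $\rho$ from the axis. Two cylinders are the same if and only if they have the same axis (as a line) and the same radius. The center of the tetrahedron is the mean of its four vertices. *)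

(* Defs.v *)
From HB Require Import structures.
From mathcomp Require Import all_boot all_order all_algebra.
From mathcomp Require Import all_classical all_reals.

Set Implicit Arguments.
Unset Strict Implicit.
Unset Printing Implicit Defensive.

Import Order.TTheory GRing.Theory Num.Theory.
Local Open Scope classical_set_scope.
Local Open Scope ring_scope.

(** Euclidean space E^3 is 'rV[R]_3 with R : realType and the
    distance [edist] below; the library norm on 'rV[R]_n is the sup norm, and
    its dot product (spectral.v) is only for numClosedFieldType. *)

Section Euclidean.
Variable R : realType.
Implicit Types (u v p : 'rV[R]_3) (L A V : set 'rV[R]_3).

Definition dot u v : R := \sum_i u 0 i * v 0 i.

Definition edist u v : R := Num.sqrt (dot (u - v) (u - v)).

Definition dist_to p A : R := inf [set edist p q | q in A].

Definition line_through u v : set 'rV[R]_3 := range (fun t : R => u + t *: (v - u)).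

Definition is_line L := exists u v, u != v /\ L = line_through u v.

(** The vector subspace of all differences of points of [L]: two lines are
    parallel (possibly equal) iff they have the same direction. *)
Definition direction L : set 'rV[R]_3 := [set p | exists2 a, L a & exists2 b, L b & p = a - b].

Definition orthogonal_lines L L' :=
  forall u v, direction L u -> direction L' v -> dot u v = 0.

(** The cylinder of axis [L] and radius [rho] is the solid
    [set p | dist_to p L <= rho].  Since cylinders are identified iff they have
    the same axis and the same radius, they are represented by this pair; the
    last two fields are propositions, so that Leibniz equality is this
    identification (lemma [cylinderP]). *)
Record cylinder := Cylinder {
  axis : set 'rV[R]_3;
  radius : R;
  axis_is_line : is_line axis;
  radius_ge0 : 0 <= radius }.

Lemma cylinderP (C C' : cylinder) :
  C = C' <-> axis C = axis C' /\ radius C = radius C'.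
Proof.
split=> [-> //|].
case: C C' => [L r hL hr] [L' r' hL' hr'] /= [eL er].
case: _ / eL hL' => hL'; case: _ / er hr' => hr'.
by rewrite (Prop_irrelevance hL hL') (Prop_irrelevance hr hr').
Qed.

Definition regular_tetrahedron (x : 'I_4 -> 'rV[R]_3) (l : R) :=
  0 < l /\ forall i j, i != j -> edist (x i) (x j) = l.

Definition center (x : 'I_4 -> 'rV[R]_3) : 'rV[R]_3 := 4%:R^-1 *: \sum_i x i.

Definition circumscribed (x : 'I_4 -> 'rV[R]_3) (C : cylinder) :=
  forall i, dist_to (x i) (axis C) = radius C.

Definition min_circumscribed (x : 'I_4 -> 'rV[R]_3) : set cylinder :=
  [set C | circumscribed x C /\
           forall C', circumscribed x C' -> radius C <= radius C'].

Definition max_circumscribed (x : 'I_4 -> 'rV[R]_3) : set cylinder :=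
  [set C | circumscribed x C /\
           forall C', circumscribed x C' -> radius C' <= radius C].

(** The vertices [x i] together with their images [2 c - x i] under the
    reflection through the center [c]. *)
Definition reflected_vertices (x : 'I_4 -> 'rV[R]_3) : set 'rV[R]_3 :=
  range x `|` range (fun i => center x *+ 2 - x i).

(** The vertices of a cube of side [s] are the eight points obtained from one
    of them, [p], by adding subsums of three mutually orthogonal vectors of
    length [s]. *)
Definition is_cube_vertex_set V :=
  exists (p : 'rV[R]_3) (e : 'I_3 -> 'rV[R]_3) (s : R),
    [/\ 0 < s,
        forall i j, dot (e i) (e j) = (if i == j then s ^+ 2 else 0) &
        V = range (fun b : {set 'I_3} => p + \sum_(i in b) e i)].

(** [u] and [v] are the endpoints of an edge of the convex polytope with vertex
    set [V]: some supporting plane [dot a _ = h] meets [V] exactly in the two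
    distinct points [u] and [v]. *)
Definition polytope_edge V u v :=
  [/\ V u, V v, u != v &
      exists a h, [/\ dot a u = h, dot a v = h &
        forall w, V w -> w != u -> w != v -> dot a w < h]].

End Euclidean.

(* Main.v *)
Require Import Defs.
From HB Require Import structures.
From mathcomp Require Import all_boot all_order all_algebra.
From mathcomp Require Import all_classical all_reals.
From mathcomp Require Import ring lra.

(** The vertices of a regular tetrahedron are four of the eight vertices of a
    cube of side [l / sqrt 2] with the same center [c].  Half edges of the cube
    form an orthogonal frame [e] of vectors of squared length [q = l ^ 2 / 8],
    in which the vertices of the tetrahedron have coordinates (1, 1, 1),
    (1, -1, -1), (-1, 1, -1) and (-1, -1, 1) relative to [c]; lengths are
    measured in this frame, and everything becomes polynomial algebra in three
    variables.

    Any line has a unit direction [d] and a point [c + p] closest to [c], with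
    [p] orthogonal to [d].  The squared distance from a vertex [v] to it is
    [q * (|v - p|^2 - <v, d>^2)].  That the four vertices give the same value
    [q * rho] is a system of equations which is linear in [p] up to the common
    term [|p|^2]; its solution is [p k = - d (k + 1) * d (k - 1)], the indices
    being cyclic modulo 3, and [rho = 2 + |p|^2] (lemma [cylinder_equations]).
    Orthogonality of [p] and [d] then says that [d 0 * d 1 * d 2 = 0].  Thus the
    circumscribed cylinders are known explicitly: there is one for each
    direction parallel to a face of the cube ([circumscribedP]).

    If [d k = 0], then [|p|^2 = a^2 * b^2] where [a] and [b], the other two
    coordinates of [d], satisfy [a^2 + b^2 = 1].  So [|p|^2] lies between [0]
    and [1 / 4].  It is [0] exactly when [d] is an axis of the cube: these three
    cylinders have their axes through [c] and squared radius [2 q = l^2 / 4].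
    It is [1 / 4] exactly when [a^2 = b^2], that is, when [d] is one of the six
    face diagonals of the cube, which are the directions of the edges of the
    tetrahedron: the squared radius is then [9 q / 4 = 9 l^2 / 32].

    For the directions of the edges of the cube, which are defined by supporting
    planes, an exchange argument ([cube_edge_toggle]) shows that the endpoints
    of an edge differ in a single coordinate. *)

Set Implicit Arguments.
Unset Strict Implicit.
Unset Printing Implicit Defensive.

Import Order.TTheory GRing.Theory Num.Theory.
Local Open Scope classical_set_scope.
Local Open Scope ring_scope.

(** * The dot product, lines, and distances to lines *)

Section Lines.
Variable R : realType.
Implicit Types (u v w p a d : 'rV[R]_3) (L : set 'rV[R]_3) (r s t : R).

Lemma dotC u v : dot u v = dot v u.
Proof. by apply: eq_bigr => i _; rewrite mulrC. Qed.

Lemma dotDl u v w : dot (u + v) w = dot u w + dot v w.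
Proof. by rewrite -big_split; apply: eq_bigr => i _ /=; rewrite mxE mulrDl. Qed.

Lemma dotZl t u v : dot (t *: u) v = t * dot u v.
Proof. by rewrite mulr_sumr; apply: eq_bigr => i _ /=; rewrite mxE mulrA. Qed.

Lemma dotNl u v : dot (- u) v = - dot u v.
Proof. by rewrite -scaleN1r dotZl mulN1r. Qed.

Lemma dotDr u v w : dot u (v + w) = dot u v + dot u w.
Proof. by rewrite !(dotC u) dotDl. Qed.

Lemma dotZr t u v : dot u (t *: v) = t * dot u v.
Proof. by rewrite !(dotC u) dotZl. Qed.

Lemma dotNr u v : dot u (- v) = - dot u v.
Proof. by rewrite !(dotC u) dotNl. Qed.

Lemma dot0l u : dot 0 u = 0.
Proof. by rewrite -(scale0r 0) dotZl mul0r. Qed.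

Definition dotE := (dotDl, dotDr, dotNl, dotNr, dotZl, dotZr).

Lemma dot_suml (I : finType) (F : I -> 'rV[R]_3) u :
  dot (\sum_i F i) u = \sum_i dot (F i) u.
Proof.
exact: (big_morph (fun v => dot v u) (fun v w => dotDl v w u) (dot0l u)).
Qed.

Lemma dot_ge0 u : 0 <= dot u u.
Proof. by apply: sumr_ge0 => i _; exact: sqr_ge0. Qed.

Lemma dot_eq0 u : (dot u u == 0) = (u == 0).
Proof.
apply/eqP/eqP => [u0|->]; last by rewrite dot0l.
apply/rowP => i; rewrite mxE; apply/eqP; rewrite -sqrf_eq0 expr2.
by move/psumr_eq0P: u0 => -> // j _; exact: sqr_ge0.
Qed.

Lemma edist_sqr u v : edist u v ^+ 2 = dot (u - v) (u - v).
Proof. by rewrite sqr_sqrtr ?dot_ge0. Qed.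

(** Lines with an explicit direction vector, so that scaling the direction is
    visible; this is a line only for [d != 0]. *)
Definition ray a d : set 'rV[R]_3 := range (fun t : R => a + t *: d).

Lemma line_throughE u v : line_through u v = ray u (v - u).
Proof. by []. Qed.

Lemma is_line_ray a d : d != 0 -> is_line (ray a d).
Proof.
move=> d0; exists a, (a + d); split; last by rewrite line_throughE addrC addKr.
by rewrite -subr_eq0 opprD addrA subrr sub0r oppr_eq0.
Qed.

Lemma direction_ray a d : direction (ray a d) = range (fun t : R => t *: d).
Proof.
apply/seteqP; split=> [_ [_ [s _ <-] [_ [t _ <-] ->]]|_ [t _ <-]].
  exists (s - t) => //.
  by rewrite opprD addrACA subrr add0r -scalerBl.
exists (a + t *: d); first by exists t.
exists a; first by exists 0; rewrite ?scale0r ?addr0.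
by rewrite addrC addKr.
Qed.

Lemma ray_reparam a d s t : t != 0 -> ray (a + s *: d) (t *: d) = ray a d.
Proof.
move=> t0; apply/seteqP; split=> _ [z _ <-].
  by exists (s + z * t) => //; rewrite scalerDl scalerA addrA.
exists ((z - s) / t) => //.
by rewrite scalerA divfK // -addrA -scalerDl addrCA subrr addr0.
Qed.

Lemma direction_scale a b d t : t != 0 ->
  direction (ray a (t *: d)) = direction (ray b d).
Proof.
move=> t0; rewrite !direction_ray; apply/seteqP; split=> _ [s _ <-].
  by exists (s * t) => //; rewrite scalerA.
by exists (s / t) => //; rewrite scalerA divfK.
Qed.

Lemma direction_line_throughC u v :
  direction (line_through u v) = direction (line_through v u).
Proof.
rewrite !line_throughE -(opprB u v) -scaleN1r; apply: direction_scale.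
by rewrite oppr_eq0 oner_eq0.
Qed.

(** The squared distance from [p] to [ray a d], by Pythagoras: the foot of the
    perpendicular is the point of parameter [dot (p - a) d / dot d d]. *)
Definition sqdist p a d := dot (p - a) (p - a) - dot (p - a) d ^+ 2 / dot d d.

Lemma edist_ray p a d t : d != 0 ->
  edist p (a + t *: d) ^+ 2 =
  sqdist p a d + dot d d * (t - dot (p - a) d / dot d d) ^+ 2.
Proof.
rewrite -dot_eq0 => d0; rewrite edist_sqr /sqdist opprD addrA.
by move: (p - a) => w; rewrite !dotE (dotC d w); field.
Qed.

Lemma dist_to_ray p a d : d != 0 -> dist_to p (ray a d) = Num.sqrt (sqdist p a d).
Proof.
move=> d0.
have foot : [set edist p q | q in ray a d] (Num.sqrt (sqdist p a d)).
  exists (a + dot (p - a) d / dot d d *: d); first by eexists.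
  rewrite -[LHS]ger0_norm ?sqrtr_ge0 // -sqrtr_sqr edist_ray //.
  by rewrite subrr expr0n mulr0 addr0.
have low : lbound [set edist p q | q in ray a d] (Num.sqrt (sqdist p a d)).
  move=> _ [_ [t _ <-] <-].
  rewrite -[leRHS]ger0_norm ?sqrtr_ge0 // -sqrtr_sqr ler_wsqrtr //.
  by rewrite edist_ray // lerDl mulr_ge0 ?dot_ge0 ?sqr_ge0.
apply/eqP; rewrite eq_le lb_le_inf ?andbT //; last by eexists; exact: foot.
by apply: ge_inf => //; eexists; exact: low.
Qed.

Lemma sqdist_ge0 p a d : d != 0 -> 0 <= sqdist p a d.
Proof.
move=> d0; have := edist_ray p a (dot (p - a) d / dot d d) d0.
by rewrite subrr expr0n mulr0 addr0 => <-; exact: sqr_ge0.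
Qed.

Lemma dist_to_rayP p a d r : d != 0 -> 0 <= r ->
  dist_to p (ray a d) = r <-> sqdist p a d = r ^+ 2.
Proof.
move=> d0 r0; rewrite dist_to_ray //; split=> [<-|->].
  by rewrite sqr_sqrtr ?sqdist_ge0.
by rewrite sqrtr_sqr ger0_norm.
Qed.

End Lines.

(** * Coordinates in an orthogonal frame *)

Section Frame.
Variables (R : realType) (c : 'rV[R]_3) (e : 'I_3 -> 'rV[R]_3) (q : R).
Hypothesis q_gt0 : 0 < q.
Hypothesis dot_frame : forall i j, dot (e i) (e j) = if i == j then q else 0.
Implicit Types (y z p d : 'I_3 -> R) (b : {set 'I_3}).

(** The indices of the three coordinates form the cyclic group of order 3.
    Statements about the coordinates [k], [k + 1], [k - 1] then hold for every
    [k] at once, instead of for three cases that are equal up to symmetry. *)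
Lemma ord3_cases (k j : 'I_3) : [\/ j = k, j = k + 1 | j = k - 1].
Proof.
by case: k => [[|[|[|//]]] ?]; case: j => [[|[|[|//]]] ?];
  (apply: Or31; exact: val_inj) || (apply: Or32; exact: val_inj)
  || (apply: Or33; exact: val_inj).
Qed.

Lemma ord3_neq (k : 'I_3) :
  ((((k + 1)%R == k) = false) * (((k - 1)%R == k) = false) *
   ((k == (k + 1)%R) = false) * ((k == (k - 1)%R) = false) *
   (((k + 1)%R == (k - 1)%R) = false) *
   (((k - 1)%R == (k + 1)%R) = false))%type.
Proof. by case: k => [[|[|[|//]]] ?]. Qed.

Lemma ord3_add (k : 'I_3) :
  (((k + 1 + 1)%R = (k - 1)%R) * ((k + 1 - 1)%R = k) *
   ((k - 1 + 1)%R = k) * ((k - 1 - 1)%R = (k + 1)%R))%type.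
Proof. by case: k => [[|[|[|//]]] ?]; do !split; exact: val_inj. Qed.

Lemma sum3 (V : nmodType) (k : 'I_3) (F : 'I_3 -> V) :
  \sum_i F i = F k + F (k + 1) + F (k - 1).
Proof.
rewrite (bigD1 k) //= (bigD1 (k + 1)) ?ord3_neq //= (bigD1 (k - 1)) ?ord3_neq //=.
rewrite big1 ?addr0 ?addrA // => i /andP[/andP[ik ik1] ik2].
by case: (ord3_cases k i) ik ik1 ik2 => ->; rewrite eqxx.
Qed.

Definition comb y : 'rV[R]_3 := \sum_i y i *: e i.

Lemma eq_comb y z : y =1 z -> comb y = comb z.
Proof. by move=> yz; apply: eq_bigr => i _; rewrite yz. Qed.

Lemma combD y z : comb (fun k => y k + z k) = comb y + comb z.
Proof. by rewrite -big_split; apply: eq_bigr => i _ /=; rewrite scalerDl. Qed.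

Lemma combZ t y : comb (fun k => t * y k) = t *: comb y.
Proof. by rewrite scaler_sumr; apply: eq_bigr => i _ /=; rewrite scalerA. Qed.

Lemma combN y : comb (fun k => - y k) = - comb y.
Proof. by rewrite -sumrN; apply: eq_bigr => i _ /=; rewrite scaleNr. Qed.

Lemma combB y z : comb (fun k => y k - z k) = comb y - comb z.
Proof. by rewrite combD combN. Qed.

Lemma comb_delta k : comb (fun i => (i == k)%:R) = e k.
Proof.
by rewrite /comb (sum3 k) !ord3_neq eqxx scale1r !scale0r !addr0.
Qed.

Lemma dot_comb_e y k : dot (comb y) (e k) = q * y k.
Proof.
rewrite /comb (sum3 k) !dotE !dot_frame eqxx !ord3_neq; ring.
Qed.

Lemma dot_comb y z : dot (comb y) (comb z) = q * \sum_k y k * z k.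
Proof.
rewrite {1}/comb dot_suml mulr_sumr; apply: eq_bigr => i _.
by rewrite dotZl dotC dot_comb_e; ring.
Qed.

Lemma comb_inj y z : comb y = comb z -> y =1 z.
Proof.
move=> yz k; have := dot_comb_e y k; rewrite yz dot_comb_e => /mulfI -> //.
by rewrite gt_eqF.
Qed.

(** The frame spans: the matrix of its rows is, up to the factor [q],
    orthogonal on one side, hence on the other. *)
Lemma comb_surj u : exists y, u = comb y.
Proof.
exists (fun k => q^-1 * dot u (e k)); rewrite combZ.
pose M := \matrix_(i < 3) e i.
have MMT : M *m (q^-1 *: M^T) = 1%:M.
  rewrite -scalemxAr; apply/matrixP => i j; rewrite !mxE.
  rewrite (eq_bigr (fun k => e i 0 k * e j 0 k)) => [|k _]; last by rewrite !mxE.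
  rewrite -/(dot (e i) (e j)) dot_frame.
  by case: eqP => _; rewrite ?mulr0 // mulVf // gt_eqF.
rewrite -[u in LHS]mulmx1 -(mulmx1C MMT) mulmxA -scalemxAr -scalemxAl; congr (_ *: _).
rewrite /comb mulmx_sum_row; apply: eq_bigr => i _; rewrite rowK; congr (_ *: _).
by rewrite mxE; apply: eq_bigr => j _; rewrite !mxE.
Qed.

Lemma comb_neq0 d : \sum_k d k ^+ 2 = 1 -> comb d != 0.
Proof.
move=> d1; rewrite -dot_eq0 dot_comb.
by rewrite (eq_bigr (fun k => d k ^+ 2)) ?d1 ?mulr1 ?gt_eqF.
Qed.

(** As [p] is orthogonal to [d], the point [c + p] is the point of the line
    closest to [c].  This normalization removes the cross terms from the
    distances to the line. *)
Lemma line_normal_form L : is_line L -> exists p d,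
  [/\ \sum_k d k ^+ 2 = 1, \sum_k p k * d k = 0 & L = ray (c + comb p) (comb d)].
Proof.
move=> [u [v [uv ->]]]; rewrite line_throughE.
have [y vu] := comb_surj (v - u); have [z uc] := comb_surj (u - c).
set n := \sum_k y k ^+ 2.
have n_gt0 : 0 < n.
  have n0 : 0 <= n by apply: sumr_ge0 => k _; exact: sqr_ge0.
  rewrite lt_neqAle n0 andbT; apply: contraNneq uv => y0.
  rewrite eq_sym -subr_eq0 -dot_eq0 vu dot_comb.
  by rewrite (eq_bigr (fun k => y k ^+ 2)) // -/n -y0 mulr0.
have s0 : Num.sqrt n != 0 by rewrite gt_eqF // sqrtr_gt0.
have sn : Num.sqrt n ^+ 2 = n by rewrite sqr_sqrtr // ltW.
pose d k := (Num.sqrt n)^-1 * y k.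
have d1 : \sum_k d k ^+ 2 = 1.
  rewrite (eq_bigr (fun k => n^-1 * y k ^+ 2)) => [|k _].
    by rewrite -mulr_sumr mulVf // gt_eqF.
  by rewrite /d exprMn exprVn sn.
have vE : v - u = Num.sqrt n *: comb d by rewrite vu combZ scalerA divff ?scale1r.
clearbody d; pose t := \sum_k z k * d k.
exists (fun k => z k + - t * d k), d; split=> //.
  rewrite (eq_bigr (fun k => z k * d k + - t * d k ^+ 2)) => [|k _]; last by ring.
  by rewrite big_split /= -mulr_sumr d1 mulr1 subrr.
transitivity (ray u (comb d)).
  by rewrite vE -{1}[u]addr0 -(scale0r (comb d)) ray_reparam.
rewrite combD combZ addrA -uc (addrC c) subrK.
by rewrite -[in RHS](scale1r (comb d)) scalerA mulr1 ray_reparam ?oner_eq0.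
Qed.

Lemma sqdist_comb v p d : \sum_k d k ^+ 2 = 1 -> \sum_k p k * d k = 0 ->
  sqdist (c + comb v) (c + comb p) (comb d) =
  q * (\sum_k (v k - p k) ^+ 2 - (\sum_k v k * d k) ^+ 2).
Proof.
move=> d1 pd; rewrite /sqdist opprD addrACA subrr add0r -combB !dot_comb.
have -> : \sum_k d k * d k = 1 by rewrite -d1; apply: eq_bigr => k _; rewrite expr2.
have -> : \sum_k (v k - p k) * d k = \sum_k v k * d k.
  rewrite (eq_bigr (fun k => v k * d k - p k * d k)) => [|k _]; last by ring.
  by rewrite sumrB pd subr0.
have -> : \sum_k (v k - p k) * (v k - p k) = \sum_k (v k - p k) ^+ 2.
  by apply: eq_bigr => k _; rewrite expr2.
by field; rewrite gt_eqF.
Qed.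

(** * Circumscribed cylinders in the frame of the cube *)

Definition sgn b (k : 'I_3) : R := if k \in b then 1 else -1.

(** The vertices of the cube are indexed by the sets of their positive
    coordinates; those of the tetrahedron are (1, 1, 1) and, for each [k], the
    one whose only positive coordinate is [k]. *)
Definition vset (i : 'I_4) : {set 'I_3} :=
  if unlift ord0 i is Some k then [set k]%SET else [set: 'I_3]%SET.

Lemma vset0 : vset ord0 = [set: 'I_3]%SET.
Proof. by rewrite /vset unlift_none. Qed.

Lemma vset_lift k : vset (lift ord0 k) = [set k]%SET.
Proof. by rewrite /vset liftK. Qed.

Lemma vset_cases i :
  vset i = [set: 'I_3]%SET \/ exists k, vset i = [set k]%SET.
Proof.
by case: (unliftP ord0 i) => [k|] ->; rewrite ?vset0 ?vset_lift; [right; exists k|left].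
Qed.

(** The coordinates of the point of the axis closest to the center, for a
    circumscribed cylinder of direction [d]. *)
Definition pos d (k : 'I_3) : R := - (d (k + 1) * d (k - 1)).

(** The four equations are those of the distances to the vertices.  The
    vertices [0] and [lift ord0 k] have opposite sums to those of the other two,
    namely twice the [k]-th vector of the frame and its opposite: the difference
    between the two pairs of equations gives [p k], and their sum gives [rho]. *)
Lemma cylinder_equations p d rho :
    \sum_k d k ^+ 2 = 1 -> \sum_k p k * d k = 0 ->
  (forall i, \sum_k (sgn (vset i) k - p k) ^+ 2
             - (\sum_k sgn (vset i) k * d k) ^+ 2 = rho) <->
  p =1 pos d /\ rho = 2 + \sum_k p k ^+ 2.
Proof.
move=> d1 pd; split=> [E|[pE ->]].
  have key k : p k = pos d k /\ rho = 2 + \sum_k p k ^+ 2.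
    have := (E ord0, E (lift ord0 k), E (lift ord0 (k + 1)), E (lift ord0 (k - 1))).
    rewrite vset0 !vset_lift /pos !(sum3 k) /sgn !inE !ord3_neq !eqxx /=.
    move: d1; rewrite (sum3 k) => d1 [[[E0 E1] E2] E3].
    split; lra.
  by split=> [k|]; [case: (key k) | case: (key 0)].
move=> i; case: (vset_cases i) => [|[k]] ->.
  move: d1 (pE 0) (pE (0 + 1)) (pE (0 - 1)).
  rewrite /pos !ord3_add !(sum3 0) /sgn !inE => d1 -> -> ->.
  lra.
move: d1 (pE k) (pE (k + 1)) (pE (k - 1)).
rewrite /pos !ord3_add !(sum3 k) /sgn !inE !ord3_neq !eqxx => d1 -> -> ->.
lra.
Qed.

Lemma pos_orthogonal d : \sum_k pos d k * d k = 0 <-> exists k, d k = 0.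
Proof.
rewrite (sum3 0) /pos !ord3_add; split=> [dd|[k]].
  have /eqP : d 0 * d (0 + 1) * d (0 - 1) = 0 by lra.
  rewrite !mulf_eq0 => /orP[/orP[]|] /eqP; by eexists; eassumption.
by case: (ord3_cases 0 k) => -> ->; ring.
Qed.

Variable x : 'I_4 -> 'rV[R]_3.
Hypothesis xE : forall i, x i = c + comb (sgn (vset i)).

Definition axis_of d := ray (c + comb (pos d)) (comb d).

(** The directions that occur are those parallel to a face of the cube, and
    each determines its cylinder.  Minimizing and maximizing the radius is thus
    an extremum problem on three great circles. *)
Lemma circumscribedP C : circumscribed x C <->
  exists d, [/\ \sum_k d k ^+ 2 = 1, exists k, d k = 0, axis C = axis_of d &
                radius C ^+ 2 = q * (2 + \sum_k pos d k ^+ 2)].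
Proof.
have q0 : q != 0 by rewrite gt_eqF.
split=> [xC|[d [d1 /pos_orthogonal pd CE rE]] i].
  have [p [d [d1 pd CE]]] := line_normal_form (axis_is_line C).
  have [pE rE] : p =1 pos d /\ radius C ^+ 2 / q = 2 + \sum_k p k ^+ 2.
    apply/(cylinder_equations _ d1 pd) => i; apply: (mulfI q0).
    rewrite -sqdist_comb // -xE mulrC divfK //.
    by apply/dist_to_rayP; rewrite ?radius_ge0 ?comb_neq0 // -CE.
  exists d; split=> //.
  - apply/pos_orthogonal; rewrite -[RHS]pd.
    by apply: eq_bigr => k _; rewrite pE.
  - by rewrite CE (eq_comb pE).
  - by rewrite -(eq_bigr _ (fun k _ => congr1 (fun r => r ^+ 2) (pE k))) -rE mulrC divfK.
rewrite CE; apply/dist_to_rayP; rewrite ?radius_ge0 ?comb_neq0 //.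
rewrite xE sqdist_comb // rE; congr (_ * _).
by move: i; apply/cylinder_equations.
Qed.

(** * Extremal radii *)

(** On the circle [d k = 0], the radius is governed by the product of the
    squares of two coordinates whose squares add up to 1. *)
Lemma parallel_to_face_sums d k : d k = 0 -> \sum_k d k ^+ 2 = 1 ->
  d (k + 1) ^+ 2 + d (k - 1) ^+ 2 = 1 /\
  \sum_k pos d k ^+ 2 = d (k + 1) ^+ 2 * d (k - 1) ^+ 2.
Proof.
by rewrite /pos !(sum3 k) !ord3_add => -> d1; split; [lra | ring].
Qed.

Definition delta (k i : 'I_3) : R := (i == k)%:R.

(** The two unit vectors with [ks.1] are the directions of the two diagonals of
    a face of the cube orthogonal to the axis [ks.1]. *)
Definition diag (ks : 'I_3 * bool) (i : 'I_3) : R :=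
  if i == ks.1 then 0
  else (if ks.2 && (i == ks.1 - 1) then -1 else 1) / Num.sqrt 2.

Lemma delta1 k : \sum_i delta k i ^+ 2 = 1.
Proof. by rewrite (sum3 k) /delta !ord3_neq eqxx expr1n expr0n !addr0. Qed.

Lemma delta0 k : exists i, delta k i = 0.
Proof. by exists (k + 1); rewrite /delta !ord3_neq. Qed.

Lemma pos_delta k i : pos (delta k) i = 0.
Proof.
rewrite /pos /delta.
by case: (ord3_cases k i) => ->; rewrite ?ord3_add ?ord3_neq ?mul0r ?mulr0 oppr0.
Qed.

Lemma sqr_invsqrt2 : (Num.sqrt 2)^-1 ^+ 2 = 2^-1 :> R.
Proof. by rewrite exprVn sqr_sqrtr. Qed.

Lemma diag1 ks : \sum_i diag ks i ^+ 2 = 1.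
Proof.
case: ks => k s; rewrite (sum3 k) /diag /= !ord3_neq !eqxx andbF andbT.
by rewrite !exprMn sqr_invsqrt2; case: s; field.
Qed.

Lemma diag0 ks : exists i, diag ks i = 0.
Proof. by exists ks.1; rewrite /diag eqxx. Qed.

Lemma sum_pos_diag ks : \sum_i pos (diag ks) i ^+ 2 = 4^-1.
Proof.
have k0 : diag ks ks.1 = 0 by rewrite /diag eqxx.
have [_ ->] := parallel_to_face_sums k0 (diag1 ks).
rewrite /diag !ord3_neq eqxx andbF andbT !exprMn sqr_invsqrt2.
by case: ks.2; field.
Qed.

Lemma sum_pos_ge0 d : 0 <= \sum_k pos d k ^+ 2.
Proof. by apply: sumr_ge0 => k _; exact: sqr_ge0. Qed.

(** The inequality of arithmetic and geometric means for two squares of sum 1. *)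
Lemma sum_pos_le d : \sum_k d k ^+ 2 = 1 -> (exists k, d k = 0) ->
  \sum_k pos d k ^+ 2 <= 4^-1.
Proof.
move=> d1 [k /parallel_to_face_sums/(_ d1)[s1 ->]].
have := sqr_ge0 (d (k + 1) ^+ 2 - d (k - 1) ^+ 2); nra.
Qed.

Lemma sqr_eq_cases (y t : R) : y ^+ 2 = t ^+ 2 -> exists2 s : R, s ^+ 2 = 1 & y = s * t.
Proof.
move/eqP; rewrite eqf_sqr => /orP[]/eqP->.
  by exists 1; rewrite ?expr1n ?mul1r.
by exists (-1); rewrite ?sqrrN ?expr1n ?mulN1r.
Qed.

Lemma pos_scale s d : s ^+ 2 = 1 -> pos (fun k => s * d k) =1 pos d.
Proof. by move=> s1 k; rewrite /pos mulrACA -expr2 s1 mul1r. Qed.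

(** [pos] is quadratic, so that opposite unit directions give the same axis. *)
Lemma axis_of_scale s d d' : s ^+ 2 = 1 -> d =1 (fun k => s * d' k) ->
  axis_of d = axis_of d'.
Proof.
move=> s1 dE; rewrite /axis_of (eq_comb dE) combZ.
have -> : comb (pos d) = comb (pos d').
  by apply: eq_comb => k; rewrite -(pos_scale d' s1) /pos !dE.
rewrite -{1}[c + _]addr0 -(scale0r (comb d')) ray_reparam //.
by apply: contra_eq_neq s1 => ->; rewrite expr0n eq_sym oner_eq0.
Qed.

Lemma axis_of_delta d : \sum_k d k ^+ 2 = 1 -> \sum_k pos d k ^+ 2 = 0 ->
  (exists k, d k = 0) -> exists k, axis_of d = axis_of (delta k).
Proof.
move=> d1 p0 [k dk]; have [s1 pE] := parallel_to_face_sums dk d1.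
have /eqP : d (k + 1) ^+ 2 * d (k - 1) ^+ 2 = 0 by rewrite -pE.
rewrite mulf_eq0 !sqrf_eq0 => /orP[]/eqP dk'.
- exists (k - 1); apply: (@axis_of_scale (d (k - 1))); first by move: s1; rewrite dk'; lra.
  move=> i; rewrite /delta; case: (ord3_cases k i) => ->;
    by rewrite ?ord3_neq ?eqxx ?dk ?dk' ?mulr0 ?mulr1.
- exists (k + 1); apply: (@axis_of_scale (d (k + 1))); first by move: s1; rewrite dk'; lra.
  move=> i; rewrite /delta; case: (ord3_cases k i) => ->;
    by rewrite ?ord3_neq ?eqxx ?dk ?dk' ?mulr0 ?mulr1.
Qed.

(** The equality case of [sum_pos_le]: two squares with sum 1 and product 1 / 4
    are equal. *)
Lemma axis_of_diag d : \sum_k d k ^+ 2 = 1 -> \sum_k pos d k ^+ 2 = 4^-1 ->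
  (exists k, d k = 0) -> exists ks, axis_of d = axis_of (diag ks).
Proof.
move=> d1 p0 [k dk]; have [s1 pE] := parallel_to_face_sums dk d1.
(* With a and b the two nonzero coordinates,
   (a^2 - b^2)^2 = (a^2 + b^2)^2 - 4 a^2 b^2 = 0. *)
have ab : d (k + 1) ^+ 2 * d (k - 1) ^+ 2 = 4^-1 by rewrite -pE.
have a2 : d (k + 1) ^+ 2 = (Num.sqrt 2)^-1 ^+ 2.
  rewrite sqr_invsqrt2; nra.
have b2 : d (k - 1) ^+ 2 = d (k + 1) ^+ 2.
  rewrite sqr_invsqrt2 in a2; lra.
have [s ss aE] := sqr_eq_cases a2.
have {b2} /eqP := b2; rewrite eqf_sqr => /orP[]/eqP bE.
- exists (k, false); apply: (axis_of_scale ss) => i; rewrite /diag.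
  by case: (ord3_cases k i) => ->; rewrite ?ord3_neq ?eqxx /= ?dk ?bE ?aE; ring.
- exists (k, true); apply: (axis_of_scale ss) => i; rewrite /diag.
  by case: (ord3_cases k i) => ->; rewrite ?ord3_neq ?eqxx /= ?dk ?bE ?aE; ring.
Qed.

Lemma is_line_axis_of d : \sum_k d k ^+ 2 = 1 -> is_line (axis_of d).
Proof. by move=> d1; apply: is_line_ray; exact: comb_neq0. Qed.

Definition cyl d (d1 : \sum_k d k ^+ 2 = 1) : cylinder R :=
  Cylinder (is_line_axis_of d1) (sqrtr_ge0 (q * (2 + \sum_k pos d k ^+ 2))).

Lemma circumscribed_cyl C : circumscribed x C <->
  exists d (d1 : \sum_k d k ^+ 2 = 1), (exists k, d k = 0) /\ C = cyl d1.
Proof.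
rewrite circumscribedP; split=> [[d [d1 d0 CE rE]]|[d [d1 [d0 ->]]]].
  exists d, d1; split=> //; apply/cylinderP; split=> //=.
  by rewrite -rE sqrtr_sqr ger0_norm ?radius_ge0.
exists d; split=> //=; rewrite sqr_sqrtr // mulr_ge0 // ?ltW //.
by rewrite ltr_wpDr ?sum_pos_ge0.
Qed.

Lemma cyl_eq d d' (d1 : \sum_k d k ^+ 2 = 1) (d1' : \sum_k d' k ^+ 2 = 1) :
  axis_of d = axis_of d' -> \sum_k pos d k ^+ 2 = \sum_k pos d' k ^+ 2 ->
  cyl d1 = cyl d1'.
Proof. by move=> dd pp; apply/cylinderP; split=> //=; rewrite pp. Qed.

Lemma le_radius_cyl d d' (d1 : \sum_k d k ^+ 2 = 1) (d1' : \sum_k d' k ^+ 2 = 1) :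
  (radius (cyl d1) <= radius (cyl d1')) =
  (\sum_k pos d k ^+ 2 <= \sum_k pos d' k ^+ 2).
Proof.
by rewrite /= ler_sqrt ?ler_pM2l ?lerD2l // mulr_ge0 ?addr_ge0 ?sum_pos_ge0 // ltW.
Qed.

Lemma sum_pos_delta k : \sum_i pos (delta k) i ^+ 2 = 0.
Proof. by rewrite big1 // => i _; rewrite pos_delta expr0n. Qed.

Lemma min_circumscribedE : min_circumscribed x = range (fun k => cyl (delta1 k)).
Proof.
have circ k : circumscribed x (cyl (delta1 k)).
  by apply/circumscribed_cyl; exists (delta k), (delta1 k); split=> //; exact: delta0.
apply/seteqP; split=> [C [/circumscribed_cyl[d [d1 [d0 ->]]] minC]|_ [k _ <-]].
  have := minC _ (circ 0); rewrite le_radius_cyl sum_pos_delta => p_le0.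
  have p0 : \sum_k pos d k ^+ 2 = 0 by apply/eqP; rewrite eq_le p_le0 sum_pos_ge0.
  have [k dk] := axis_of_delta d1 p0 d0.
  by exists k => //; apply: cyl_eq; rewrite ?dk ?p0 ?sum_pos_delta.
split=> [|_ /circumscribed_cyl[d [d1 [_ ->]]]]; first exact: circ.
by rewrite le_radius_cyl sum_pos_delta sum_pos_ge0.
Qed.

Lemma max_circumscribedE : max_circumscribed x = range (fun ks => cyl (diag1 ks)).
Proof.
have circ ks : circumscribed x (cyl (diag1 ks)).
  by apply/circumscribed_cyl; exists (diag ks), (diag1 ks); split=> //; exact: diag0.
apply/seteqP; split=> [C [/circumscribed_cyl[d [d1 [d0 ->]]] maxC]|_ [ks _ <-]].
  have := maxC _ (circ (0, false)); rewrite le_radius_cyl sum_pos_diag => p_ge.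
  have p4 : \sum_k pos d k ^+ 2 = 4^-1 by apply/eqP; rewrite eq_le p_ge sum_pos_le.
  have [ks dks] := axis_of_diag d1 p4 d0.
  by exists ks => //; apply: cyl_eq; rewrite ?dks ?p4 ?sum_pos_diag.
split=> [|_ /circumscribed_cyl[d [d1 [d0 ->]]]]; first exact: circ.
by rewrite le_radius_cyl sum_pos_diag sum_pos_le.
Qed.

Lemma axis_of_eq d d' : axis_of d = axis_of d' -> exists t, d =1 (fun k => t * d' k).
Proof.
move/(congr1 (@direction R)); rewrite !direction_ray => dd.
have : range (fun t => t *: comb d') (comb d).
  by rewrite -dd; exists 1; rewrite ?scale1r.
by case=> t _; rewrite -combZ => /comb_inj tE; exists t => k; rewrite tE.
Qed.

Lemma cyl_delta_inj : injective (fun k => cyl (delta1 k)).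
Proof.
move=> k j /cylinderP[/= /axis_of_eq[t tE] _]; apply/eqP.
by have := tE k; rewrite /delta eqxx; case: eqP => // _ /eqP; rewrite mulr0 oner_eq0.
Qed.

Lemma sqrt2_neq0 : Num.sqrt 2 != 0 :> R.
Proof. by rewrite gt_eqF // sqrtr_gt0. Qed.

Lemma cyl_diag_inj : injective (fun ks => cyl (diag1 ks)).
Proof.
move=> [k s] [j s'] /cylinderP[/= /axis_of_eq[t tE] _].
have s2 := sqrt2_neq0.
have nz (b : bool) : (if b then -1 else 1) / Num.sqrt 2 != 0 :> R.
  by rewrite mulf_neq0 ?invr_eq0 //; case: b; rewrite ?oppr_eq0 oner_eq0.
have kj : k = j.
  have := tE j; rewrite /diag /= eqxx mulr0; case: (j =P k) => // _ /eqP.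
  by rewrite (negPf (nz _)).
subst j; have t1 : t = 1.
  apply: (mulIf (nz false)).
  by have := tE (k + 1); rewrite /diag /= !ord3_neq !andbF !mul1r => <-.
congr pair; have := tE (k - 1); rewrite /diag /= !ord3_neq !eqxx !andbT t1 mul1r.
move/mulIf; rewrite invr_eq0 => /(_ s2).
by case: s tE => [tE|tE]; case: s' tE => // tE; lra.
Qed.

Lemma axis_of_deltaE k : axis_of (delta k) = ray c (e k).
Proof.
rewrite /axis_of comb_delta (eq_comb (pos_delta k)) /comb big1 ?addr0 // => i _.
by rewrite scale0r.
Qed.

Lemma frame_axes_meet k j : k != j -> ray c (e k) `&` ray c (e j) = [set c].
Proof.
move=> kj; apply/seteqP; split=> [_ [[s _ <-] [t _ /addrI tE]]|_ ->]; last first.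
  by split; exists 0; rewrite ?scale0r ?addr0.
have := congr1 (dot (e k)) tE; rewrite !dotE !dot_frame eqxx (negPf kj) mulr0.
by move/esym/eqP; rewrite mulf_eq0 (gt_eqF q_gt0) orbF => /eqP->; rewrite scale0r addr0.
Qed.

Lemma frame_axes_orthogonal k j : k != j -> orthogonal_lines (ray c (e k)) (ray c (e j)).
Proof.
move=> kj u v; rewrite !direction_ray => -[s _ <-] [t _ <-].
by rewrite !dotE dot_frame (negPf kj) !mulr0.
Qed.

(** * The cube *)

Definition cube_vertex b := c + comb (sgn b).

Lemma cube_vertex_inj : injective cube_vertex.
Proof.
move=> b b' /addrI/comb_inj bb; apply/setP => k; have := bb k; rewrite /sgn.
by case: (k \in b); case: (k \in b') => // /eqP; rewrite -subr_eq0 => /eqP; lra.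
Qed.

Lemma sgn_compl b k : sgn (~: b)%SET k = - sgn b k.
Proof. by rewrite /sgn inE; case: (k \in b); rewrite /= ?opprK. Qed.

Lemma vset_or_compl b : exists i, b = vset i \/ b = (~: vset i)%SET.
Proof.
have : (#|b| + #|~: b| = 3)%N by rewrite cardsC card_ord.
case Eb: #|b| => [|[|[|n]]].
- by move=> _; exists ord0; right; rewrite vset0 finset.setCT; exact: cards0_eq.
- move/eqP/cards1P: Eb => [k ->] _.
  by exists (lift ord0 k); left; rewrite vset_lift.
- move=> [] /eqP/cards1P[k bE]; exists (lift ord0 k); right.
  by rewrite vset_lift -bE finset.setCK.
- rewrite !addSn => -[] /eqP; rewrite addn_eq0 => /andP[_ /eqP bC].
  by exists ord0; left; rewrite vset0 -[b]finset.setCK (cards0_eq bC) finset.setC0.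
Qed.

Hypothesis cE : c = center x.

Lemma reflected_verticesE : reflected_vertices x = range cube_vertex.
Proof.
have refl i : center x *+ 2 - x i = cube_vertex (~: vset i).
  rewrite -cE xE opprD addrA mulr2n addrK /cube_vertex -combN.
  by congr (_ + _); apply: eq_comb => k; rewrite sgn_compl.
apply/seteqP; split=> [_ [[i _ <-]|[i _ <-]]|_ [b _ <-]].
- by exists (vset i); rewrite // xE.
- by rewrite refl; eexists.
have [i [->|->]] := vset_or_compl b.
- by left; exists i; rewrite // xE.
- by right; exists i; rewrite // refl.
Qed.

Lemma is_cube_reflected_vertices : is_cube_vertex_set (reflected_vertices x).
Proof.
exists (c - comb (fun=> 1)), (fun i => 2 *: e i), (2 * Num.sqrt q); split.
- by rewrite mulr_gt0 // sqrtr_gt0.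
- move=> i j; rewrite !dotE dot_frame exprMn sqr_sqrtr ?ltW //.
  by case: eqP => _; ring.
rewrite reflected_verticesE; apply: (congr1 (fun f => range f)); apply: funext => b.
rewrite /cube_vertex -addrA; congr (_ + _).
rewrite big_mkcond /= -[in RHS]combN.
rewrite (eq_bigr (fun i => (if i \in b then 2 else 0) *: e i)) => [|i _]; last first.
  by case: ifP => // _; rewrite scale0r.
rewrite -/(comb (fun i => if i \in b then 2 else 0)) -combD.
by apply: eq_comb => i; rewrite /sgn; case: ifP => _; ring.
Qed.

(** The supporting form is proportional to the sum of the two coordinates other
    than [k]; it is maximal on the cube when both are positive, which leaves
    only coordinate [k] free. *)
Lemma cube_edge k :
  polytope_edge (reflected_vertices x)
    (cube_vertex [set: 'I_3]%SET) (cube_vertex (~: [set k]%SET)).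
Proof.
rewrite reflected_verticesE; split; try by eexists.
  by apply/eqP => /cube_vertex_inj/setP/(_ k); rewrite !inE eqxx.
pose a := comb (fun i => (i != k)%:R).
have aE b : dot a (cube_vertex b) = dot a c + q * (sgn b (k + 1) + sgn b (k - 1)).
  by rewrite dotDr dot_comb (sum3 k) !ord3_neq eqxx mul0r add0r !mul1r.
exists a, (dot a c + q * 2); split.
- by rewrite aE /sgn !inE; ring.
- by rewrite aE /sgn !inE !ord3_neq /=; ring.
move=> _ [b _ <-] /eqP bT /eqP bk; rewrite aE ltrD2l ltr_pM2l // /sgn.
case: ifP => [b1|_]; case: ifP => [b2|_]; try lra.
case: (boolP (k \in b)) => kb.
  by case: bT; congr cube_vertex; apply/setP => i; case: (ord3_cases k i) => ->;
    rewrite !inE ?kb ?b1 ?b2.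
by case: bk; congr cube_vertex; apply/setP => i; case: (ord3_cases k i) => ->;
  rewrite !inE ?ord3_neq ?eqxx ?(negPf kb) ?b1 ?b2.
Qed.

Definition toggle i b : {set 'I_3} := [set j | (j \in b) (+) (j == i)]%SET.

(** If the vertices [b] and [b'] differ in coordinate [i], exchanging this
    coordinate gives two vertices with the same sum.  Were they not [b'] and [b]
    again, the supporting form of the edge would be smaller at both of them, and
    so on their sum. *)
Lemma cube_edge_toggle b b' :
  polytope_edge (reflected_vertices x) (cube_vertex b) (cube_vertex b') ->
  exists i, b' = toggle i b.
Proof.
rewrite reflected_verticesE => -[_ _ bb [a [h [ab ab' ah]]]].
have /existsP[i ib] : [exists i, (i \in b) != (i \in b')].
  apply: contraNT bb; rewrite negb_exists => /forallP bb.
  by apply/eqP; congr cube_vertex; apply/setP => i; move/negPn/eqP: (bb i).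
exists i; apply/eqP; apply: contraT => b'i.
have toggleK : involutive (toggle i).
  by move=> B; apply/setP => j; rewrite !inE addbK.
have toggle_neq B : toggle i B != B.
  by apply/eqP => /setP/(_ i); rewrite !inE eqxx; case: (i \in B).
have neq B B' : B != B' -> cube_vertex B != cube_vertex B'.
  by rewrite (inj_eq cube_vertex_inj).
have ib' : toggle i b != b' by rewrite eq_sym.
have bi' : toggle i b' != b by apply: contraNneq b'i => <-; rewrite toggleK.
have lt1 := ah _ (imageT _ (toggle i b)) (neq _ _ (toggle_neq b))
  (neq _ _ ib').
have lt2 := ah _ (imageT _ (toggle i b')) (neq _ _ bi') (neq _ _ (toggle_neq b')).
have sumE : cube_vertex (toggle i b) + cube_vertex (toggle i b') =
            cube_vertex b + cube_vertex b'.
  rewrite /cube_vertex addrACA [RHS]addrACA -!combD; congr (_ + _); apply: eq_comb => j.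
  rewrite /sgn !inE; case: (eqVneq j i) => [->|_]; last by rewrite !addbF.
  by case: (i \in b) ib; case: (i \in b') => //= _; rewrite addrC.
by have := congr1 (dot a) sumE; rewrite dotDr [RHS]dotDr ab ab'; lra.
Qed.

Lemma sgn_toggle i b k : sgn (toggle i b) k - sgn b k = - 2 * sgn b i * delta i k.
Proof.
rewrite /sgn /delta !inE; case: (eqVneq k i) => [->|_].
  by case: (i \in b) => /=; ring.
by rewrite addbF subrr mulr0.
Qed.

Lemma direction_toggle i b :
  direction (line_through (cube_vertex b) (cube_vertex (toggle i b))) =
  direction (axis_of (delta i)).
Proof.
rewrite line_throughE opprD addrACA subrr add0r -combB.
rewrite (eq_comb (sgn_toggle i b)) combZ /axis_of; apply: direction_scale.
by rewrite /sgn; case: ifP => _; rewrite ?mulrN ?mulr1 ?oppr_eq0 ?pnatr_eq0.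
Qed.

Lemma min_directions :
  [set D | exists2 C, min_circumscribed x C & D = direction (axis C)] =
  [set D | exists u v, polytope_edge (reflected_vertices x) u v /\
                       D = direction (line_through u v)].
Proof.
rewrite min_circumscribedE; apply/seteqP; split=> D /=.
  move=> [_ [k _ <-] ->] /=; do 2!eexists; split; first exact: (cube_edge k).
  rewrite -(direction_toggle k [set: 'I_3]%SET);
  congr (direction (line_through _ (cube_vertex _))).
  by apply/setP => j; rewrite !inE.
move=> [u [v [uv ->]]].
have [[b _ ub] [b' _ vb]] : range cube_vertex u /\ range cube_vertex v.
  by rewrite -reflected_verticesE; case: uv.
subst u v; have [i ->] := cube_edge_toggle uv.
by exists (cyl (delta1 i)); rewrite ?direction_toggle //; eexists.
Qed.

(** * The edges of the tetrahedron *)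

Lemma edge_direction i j ks t : t != 0 ->
  (forall k, sgn (vset j) k - sgn (vset i) k = t * diag ks k) ->
  direction (line_through (x i) (x j)) = direction (axis_of (diag ks)).
Proof.
move=> t0 tE; rewrite line_throughE !xE opprD addrACA subrr add0r -combB.
by rewrite (eq_comb tE) combZ; exact: direction_scale.
Qed.

(** Twice the vector of the frame number [k] is the sum of vertices [0] and
    [lift ord0 k] (relative to the center); the edge between these two vertices
    is a diagonal of a face orthogonal to it, and the opposite edge of the
    tetrahedron is parallel to the other diagonal ([edge_direction1]). *)
Lemma edge_direction0 k :
  direction (line_through (x (lift ord0 k)) (x ord0)) =
  direction (axis_of (diag (k, false))).
Proof.
have s2 := sqrt2_neq0.
apply: (@edge_direction _ _ _ (2 * Num.sqrt 2)); first by rewrite mulf_neq0 ?pnatr_eq0.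
move=> i; rewrite vset0 vset_lift /sgn /diag !inE /=.
by case: eqP => _; [ring | field].
Qed.

Lemma edge_direction1 k :
  direction (line_through (x (lift ord0 (k - 1))) (x (lift ord0 (k + 1)))) =
  direction (axis_of (diag (k, true))).
Proof.
have s2 := sqrt2_neq0.
apply: (@edge_direction _ _ _ (2 * Num.sqrt 2)); first by rewrite mulf_neq0 ?pnatr_eq0.
move=> i; rewrite !vset_lift /sgn /diag !inE /=.
by case: (ord3_cases k i) => ->; rewrite ?ord3_neq ?eqxx /=; field.
Qed.

Lemma max_directions :
  [set D | exists2 C, max_circumscribed x C & D = direction (axis C)] =
  [set D | exists i j : 'I_4, i != j /\ D = direction (line_through (x i) (x j))].
Proof.
rewrite max_circumscribedE; apply/seteqP; split=> D /=.
  move=> [_ [[k [] _ <-] ->]] /=.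
    exists (lift ord0 (k - 1)), (lift ord0 (k + 1)).
    by rewrite (inj_eq lift_inj) ord3_neq edge_direction1.
  exists (lift ord0 k), ord0; split; last by rewrite edge_direction0.
  by rewrite eq_sym neq_lift.
have diagP ks : exists2 C, range (fun ks => cyl (diag1 ks)) C &
    direction (axis_of (diag ks)) = direction (axis C).
  by exists (cyl (diag1 ks)); first by eexists.
move=> [i [j [+ ->]]].
case: (unliftP ord0 i) => [k|] ->; case: (unliftP ord0 j) => [m|] -> //; last 2 first.
- by move=> _; rewrite edge_direction0.
- by move=> _; rewrite direction_line_throughC edge_direction0.
rewrite (inj_eq lift_inj) => km.
case: (ord3_cases k m) km => ->; rewrite ?eqxx // => _.
  have := edge_direction1 (k - 1); rewrite !ord3_add => kE.
  by rewrite direction_line_throughC kE.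
by have := edge_direction1 (k + 1); rewrite !ord3_add => ->.
Qed.

End Frame.

(** * From a regular tetrahedron to the frame of its cube *)

Section Tetrahedron.
Variables (R : realType) (x : 'I_4 -> 'rV[R]_3) (l : R).
Hypothesis hx : regular_tetrahedron x l.

(** Each face of the cube has an edge of the tetrahedron as a diagonal, whose
    midpoint is the center of the face; these are the faces at vertex [0], seen
    from the center of the cube. *)
Definition face_center (k : 'I_3) : 'rV[R]_3 :=
  2^-1 *: (x ord0 + x (lift ord0 k)) - center x.

(** The Gram matrix of the three edges at a vertex is read off the side
    lengths, by polarization; it determines that of the face centers. *)
Definition edge0 (k : 'I_3) := x (lift ord0 k) - x ord0.

Lemma dot_edge0 j k : dot (edge0 j) (edge0 k) = if j == k then l ^+ 2 else l ^+ 2 / 2.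
Proof.
have side i i' : i != i' -> dot (x i - x i') (x i - x i') = l ^+ 2.
  by move=> ii; rewrite -edist_sqr hx.2.
have edge1 m : dot (edge0 m) (edge0 m) = l ^+ 2 by rewrite side // eq_sym neq_lift.
case: (eqVneq j k) => [->|jk]; first exact: edge1.
have : dot (edge0 j - edge0 k) (edge0 j - edge0 k) = l ^+ 2.
  by rewrite /edge0 opprB addrA subrK side // (inj_eq lift_inj).
move: edge1; move: edge0 => w edge1.
rewrite !dotE !edge1 (dotC (w k)); lra.
Qed.

Lemma centerE : center x = 4^-1 *: (x ord0 + \sum_k x (lift ord0 k)).
Proof. by rewrite /center big_ord_recl. Qed.

Lemma face_centerE k : face_center k = 2^-1 *: edge0 k - 4^-1 *: \sum_i edge0 i.
Proof.
rewrite /face_center centerE /edge0 !(sum3 k); apply/rowP => i; rewrite !mxE.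
by field.
Qed.

Lemma dot_face_center j k :
  dot (face_center j) (face_center k) = if j == k then l ^+ 2 / 8 else 0.
Proof.
rewrite !face_centerE (sum3 k); move: edge0 dot_edge0 => w wE; rewrite !dotE !wE.
by case: (ord3_cases k j) => ->; rewrite ?ord3_neq ?eqxx; field.
Qed.

Lemma vertexE i : x i = center x + comb face_center (sgn R (vset i)).
Proof.
rewrite /comb; case: (unliftP ord0 i) => [k|] ->; [|pose k : 'I_3 := 0];
  rewrite (sum3 k) ?vset0 ?vset_lift /sgn !inE ?ord3_neq ?eqxx /face_center;
  by rewrite centerE (sum3 k); apply/rowP => j; rewrite !mxE; field.
Qed.

End Tetrahedron.

Lemma card_range_inj (T : finType) (U : Type) (f : T -> U) :
  injective f -> (range f #= `I_#|T|)%card.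
Proof.
move=> f_inj.
have -> : range f = range (f \o enum_val : 'I_#|T| -> U).
  apply/seteqP; split=> _ [t _ <-]; last by exists (enum_val t).
  by exists (enum_rank t); rewrite //= enum_rankK.
apply: (card_eq_trans (inj_card_eq _)); last by rewrite card_eq_sym card_II.
by move=> i j _ _ /f_inj/enum_val_inj.
Qed.

Theorem theorem1 (R : realType) (x : 'I_4 -> 'rV[R]_3) (l : R)
    (hx : regular_tetrahedron x l) :
  (* (a) *)
  [/\ (min_circumscribed x #= `I_3)%card,
      forall C, min_circumscribed x C -> radius C / l = 1 / 2%:R,
      forall C C', min_circumscribed x C -> min_circumscribed x C' -> C <> C' ->
        axis C `&` axis C' = [set center x] /\
        orthogonal_lines (axis C) (axis C'),
      is_cube_vertex_set (reflected_vertices x) &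
      [set D | exists2 C, min_circumscribed x C & D = direction (axis C)] =
      [set D | exists u v, polytope_edge (reflected_vertices x) u v /\
                           D = direction (line_through u v)]]
  /\
  (* (b) *)
  [/\ (max_circumscribed x #= `I_6)%card,
      forall C, max_circumscribed x C ->
        radius C / l = 3%:R * Num.sqrt 2%:R / 8%:R &
      [set D | exists2 C, max_circumscribed x C & D = direction (axis C)] =
      [set D | exists i j : 'I_4, i != j /\
                           D = direction (line_through (x i) (x j))]].
Proof.
have l_gt0 := hx.1; have l0 : l != 0 by rewrite gt_eqF.
have q_gt0 : 0 < l ^+ 2 / 8 by rewrite divr_gt0 // exprn_gt0.
have eE := dot_face_center hx; have xE := vertexE x; have cE := erefl (center x).
have minE := min_circumscribedE q_gt0 eE xE.
have maxE := max_circumscribedE q_gt0 eE xE.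
have radiusE s t : 0 <= t -> s = 8 * t ^+ 2 -> Num.sqrt (l ^+ 2 / 8 * s) / l = t.
  move=> t0 ->; have -> : l ^+ 2 / 8 * (8 * t ^+ 2) = (l * t) ^+ 2 by field.
  by rewrite sqrtr_sqr ger0_norm; [field | rewrite mulr_ge0 // ltW].
split; split.
- have -> : 3%N = #|'I_3| by rewrite card_ord.
  rewrite minE; apply: card_range_inj; exact: cyl_delta_inj.
- rewrite minE => _ [k _ <-] /=; rewrite sum_pos_delta.
  by apply: radiusE; [lra | field].
- rewrite minE => _ _ [k _ <-] [j _ <-] kj /=; rewrite !axis_of_deltaE.
  have {}kj : k != j by apply: contra_not_neq kj => ->.
  split; [exact: (frame_axes_meet _ q_gt0 eE) | exact: (frame_axes_orthogonal eE)].
- exact: (is_cube_reflected_vertices q_gt0 eE xE cE).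
- exact: (min_directions q_gt0 eE xE cE).
- have -> : 6%N = #|{: 'I_3 * bool}| by rewrite card_prod card_ord card_bool.
  rewrite maxE; apply: card_range_inj; exact: cyl_diag_inj.
- rewrite maxE => _ [ks _ <-] /=; rewrite sum_pos_diag.
  apply: radiusE; first by rewrite divr_ge0 ?mulr_ge0 ?sqrtr_ge0 ?ler0n.
  by rewrite !exprMn sqr_sqrtr //; field.
- exact: (max_directions q_gt0 eE xE).
Qed.
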